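(* For almost all graphs $G$, $md(G)=1$ holds. That is, if $G$ is a random graph on $n$ labelled vertices in which each pair of vertices is chosen as an edge independently with probability $\frac12$, then the probability that $G$ is connected and $md(G)=1$ tends to $1$ as $n\to\infty$.
   Context: Graphs are finite and simple. An edge-coloring of a graph $G$ is an arbitrary map from $E(G)$ to a finite set of colors (adjacent edges may receive the same color). For two distinct vertices $u,v$ of an edge-colored graph $G$, a monochromatic $uv$-cut is a set $M$ of edges, all of the same color, such that $u$ and $v$ lie in different components of $G-M$. An edge-coloring of $G$ is an $MD$-coloring (monochromatic disconnection coloring) if every two distinct vertices of $G$ are separated by a monochromatic cut. For a connected graph $G$, the monochromatic disconnection number $md(G)$ is the maximum number of colors actually used on $E(G)$ over all $MD$-colorings of $G$. ''Almost all graphs'' is understood with respect to the random graph model $\mathcal{G}_{n,1/2}$ as $n\to\infty$. *)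

(* Defs.v *)
From HB Require Import structures.
From mathcomp Require Import all_boot all_order all_algebra.
From mathcomp Require Import all_classical all_reals all_analysis.

Set Implicit Arguments.
Unset Strict Implicit.
Unset Printing Implicit Defensive.

Import Order.TTheory GRing.Theory Num.Theory.

Local Open Scope nat_scope.

(* The unordered pairs of distinct vertices. *)
Definition vpairs (T : finType) : {set {set T}} := [set e : {set T} | #|e| == 2].

Record sgraph (T : finType) := SGraph {
  edges : {set {set T}};
  edges_vpairs : edges \subset vpairs T }.

HB.instance Definition _ (T : finType) := [isSub for @edges T].
HB.instance Definition _ (T : finType) := [Finite of sgraph T by <:].

Section Coloring.
Variable T : finType.
Implicit Types (G : sgraph T) (F M : {set {set T}}) (u v : T).

(* Adjacency in the graph on T with edge set F. *)
Definition adj F : rel T := fun u v => [set u; v] \in F.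

(* u and v lie in the same component of the graph on T with edge set F. *)
Definition same_comp F : rel T := connect (adj F).

Definition connected_graph G : bool :=
  (0 < #|T|) && [forall u, forall v, same_comp (edges G) u v].

(* A coloring of G is given by a function on all sets of vertices; only its
   values on edges G matter in everything below. *)
Section WithColors.
Variable C : finType.
Implicit Type c : {set T} -> C.

Definition monochromatic c M : Prop :=
  forall e f, e \in M -> f \in M -> c e = c f.

Definition mono_cut G c u v M : Prop :=
  [/\ M \subset edges G, monochromatic c M & ~~ same_comp (edges G :\: M) u v].

Definition MD_coloring G c : Prop :=
  forall u v, u != v -> exists M, mono_cut G c u v M.

Definition used_colors G c : {set C} := [set c e | e in edges G].

End WithColors.

Definition MD_with G (k : nat) : Prop :=
  exists (C : finType) (c : {set T} -> C),
    MD_coloring G c /\ #|used_colors G c| = k.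

(* The range of k is no restriction, since a coloring of G uses at most
   #|edges G| colors: see md_max and md_attained. *)
Definition md G : nat := \max_(k < #|edges G|.+1 | `[< MD_with G k >]) k.

Lemma md_max G (C : finType) (c : {set T} -> C) :
  MD_coloring G c -> #|used_colors G c| <= md G.
Proof.
move=> cMD.
have ltk : #|used_colors G c| < #|edges G|.+1 by rewrite ltnS leq_imset_card.
apply: (@leq_bigmax_cond _ _ (fun k : 'I_#|edges G|.+1 => val k) (Ordinal ltk)).
by apply/asboolP; exists C, c.
Qed.

Lemma md_attained G : MD_with G (md G).
Proof.
pose c (e : {set T}) := tt.
have cMD : MD_coloring G c.
  move=> u v neq_uv; exists (edges G); split=> //.
  rewrite finset.setDv; apply/negP => /connectP[[|x p]] /=.
    by move=> _ eq_vu; rewrite eq_vu eqxx in neq_uv.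
  by rewrite /adj finset.in_set0.
have ltk : #|used_colors G c| < #|edges G|.+1 by rewrite ltnS leq_imset_card.
have [|k Pk eq_k] := @eq_bigmax_cond 'I_#|edges G|.+1
    (fun k => `[< MD_with G k >]) (fun k => val k).
  apply/card_gt0P; exists (Ordinal ltk).
  by apply/asboolP; exists unit, c.
have -> : md G = k by rewrite -[RHS]eq_k.
by move: Pk => /asboolP.
Qed.

End Coloring.

Section RandomGraph.
Local Open Scope ring_scope.
Variables (R : realType) (p : R) (n : nat).

(* Probability of drawing exactly the graph G when every pair of vertices is
   an edge independently with probability p. *)
Definition gnp_weight (G : sgraph 'I_n) : R :=
  \prod_(e in vpairs 'I_n) (if e \in edges G then p else 1 - p).

Definition gnp_pr (A : pred (sgraph 'I_n)) : R := \sum_(G | A G) gnp_weight G.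

(* The events e \in edges G, for e a pair of vertices, are independent and have
   probability p; A = B = set0 gives total mass 1. *)
Lemma gnp_pr_indep (A B : {set {set 'I_n}}) :
    A \subset vpairs 'I_n -> B \subset vpairs 'I_n -> [disjoint A & B] ->
  gnp_pr [pred G | (A \subset edges G) && [disjoint B & edges G]]
  = p ^+ #|A| * (1 - p) ^+ #|B|.
Proof.
move=> sA sB dAB.
pose f e : R := if e \in vpairs 'I_n then (if e \in B then 0 else p) else 0.
pose g e : R :=
  if e \in vpairs 'I_n then (if e \in A then 0 else 1 - p) else 1.
have key (J : {set {set 'I_n}}) :
    \prod_e (if e \in J then f e else g e) =
    if [&& J \subset vpairs 'I_n, A \subset J & [disjoint B & J]]
    then \prod_(e in vpairs 'I_n) (if e \in J then p else 1 - p) else 0.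
  case: ifPn => [/and3P[sJ sAJ dBJ]|].
    rewrite [RHS]big_mkcond; apply: eq_bigr => e _; rewrite /f /g.
    case: ifP => eJ; last by case: ifP => // eV; rewrite (contraFF (fintype.subsetP sAJ e) eJ).
    by rewrite (fintype.subsetP sJ) // (disjointFl dBJ eJ).
  rewrite !negb_and => /or3P[/fintype.subsetPn[e eJ eV]|/fintype.subsetPn[e eA eJ]|].
  - by rewrite (bigD1 e) //= eJ /f (negbTE eV) mul0r.
  - by rewrite (bigD1 e) //= (negbTE eJ) /g (fintype.subsetP sA) // eA mul0r.
  - move=> /pred0Pn[e /= /andP[eB eJ]].
    by rewrite (bigD1 e) //= eJ /f (fintype.subsetP sB) // eB mul0r.
transitivity (\sum_(J in {set {set 'I_n}}) \prod_e (if e \in J then f e else g e)).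
  under [RHS]eq_bigr do rewrite key.
  rewrite -big_mkcond /= /gnp_pr.
  rewrite [RHS](reindex_omap (@edges 'I_n) insub) /=; last first.
    by move=> J /andP[sJ _]; rewrite insubT.
  apply: eq_bigl => G /=.
  by rewrite (valK G) eqxx andbT (edges_vpairs G).
rewrite -bigA_distr (bigID (mem (A :|: B))) /= mulrC big1 ?mul1r; last first.
  move=> e; rewrite finset.in_setU negb_or => /andP[/negbTE eA /negbTE eB].
  by rewrite /f /g eA eB; case: ifP => _; rewrite ?add0r // addrC subrK.
rewrite (eq_bigl [predU A & B]); last by move=> e; rewrite finset.in_setU.
rewrite bigU //=; congr (_ * _).
  rewrite -prodr_const; apply: eq_bigr => e eA.
  by rewrite /f /g (fintype.subsetP sA) // eA (disjointFr dAB eA) addr0.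
rewrite -prodr_const; apply: eq_bigr => e eB.
by rewrite /f /g (fintype.subsetP sB) // eB (disjointFl dAB eB) add0r.
Qed.

End RandomGraph.

(* Main.v *)
(* In an MD-coloring every triangle is monochromatic, because a cut separating
   the ends of an edge contains that edge and meets every path between them.
   If every three vertices have a common neighbour, triangles then propagate one
   color to all edges.  For a fixed triple the probability of having no common
   neighbour is (7/8)^(n-3), and the union bound over the 'C(n, 3)
   triples tends to 0. *)
Require Import Defs.
From mathcomp Require Import all_boot all_order all_algebra.
From mathcomp Require Import all_classical all_reals all_analysis.
From mathcomp Require Import ring.
Import Order.TTheory GRing.Theory Num.Theory.
Import numFieldNormedType.Exports.

Set Implicit Arguments.
Unset Strict Implicit.
Unset Printing Implicit Defensive.

(** For [F := edges G] the points of [S] are excluded automatically: if [x \in S], the choice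
    [s = x] gives a singleton, which is never an edge. *)
Definition common_neighbour (T : finType) (F : {set {set T}}) (S : {set T}) :
  pred T :=
  fun x => [forall s in S, [set s; x]%SET \in F].

Definition triples_common_neighbour (T : finType) (G : sgraph T) : bool :=
  [forall S : {set T}, (#|S| == 3) ==> [exists x, common_neighbour (edges G) S x]].

Lemma superset_of_card (T : finType) (A : {set T}) (k : nat) :
  #|A| <= k <= #|T| -> exists2 B : {set T}, A \subset B & #|B| = k.
Proof.
case/andP; elim: k => [|k IH].
  by rewrite leqn0 => /eqP A0 _; exists A.
rewrite leq_eqVlt => /orP[/eqP Ak _|Ak ltkT]; first by exists A.
have [B sAB Bk] := IH Ak (ltnW ltkT).
have /card_gt0P[x] : 0 < #|~: B| by rewrite cardsCs finset.setCK Bk subn_gt0.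
rewrite finset.in_setC => xB; exists (x |: B)%SET; last by rewrite cardsU1 xB Bk.
by apply: fintype.subset_trans sAB _; apply: finset.subsetUr.
Qed.

(** * MD-colorings of graphs in which all triples have common neighbours *)

Section Deterministic.
Variables (T : finType) (G : sgraph T).

Lemma edge_neq u v : [set u; v]%SET \in edges G -> u != v.
Proof.
move=> /(fintype.subsetP (edges_vpairs G)); rewrite inE cards2.
by case: (u != v).
Qed.

Section MD.
Variables (C : finType) (c : {set T} -> C).
Hypothesis cMD : MD_coloring G c.
Local Notation e x y := ([set x; y]%SET).

(* The cut separating [u] from [v] meets both the edge [uv] and the path [uwv]. *)
Lemma MD_triangle_edge u v w :
  e u v \in edges G -> e u w \in edges G -> e w v \in edges G ->
  c (e u v) = c (e u w) \/ c (e u v) = c (e w v).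
Proof.
move=> uv uw wv; have [M [_ cM ncomp]] := cMD (edge_neq uv).
have uvM : e u v \in M.
  apply: contraNT ncomp => uvM; apply: connect1.
  by rewrite /adj finset.in_setD uvM.
have [uwM|uwM] := boolP (e u w \in M); first by left; apply: cM.
have [wvM|wvM] := boolP (e w v \in M); first by right; apply: cM.
case/negP: ncomp; apply: (@connect_trans _ _ w); apply: connect1;
  by rewrite /adj finset.in_setD ?uwM ?wvM.
Qed.

(** Each side shares its color with another side, so no color class on the three sides is a
    singleton, and there is only one class. *)
Lemma MD_triangle u v w :
  e u v \in edges G -> e u w \in edges G -> e w v \in edges G ->
  c (e u v) = c (e u w).
Proof.
move=> uv uw wv.
have vu : e v u \in edges G by rewrite finset.setUC.
have vw : e v w \in edges G by rewrite finset.setUC.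
have := MD_triangle_edge uv uw wv.
have := MD_triangle_edge uw uv vw.
have := MD_triangle_edge wv (etrans (congr1 _ (finset.setUC _ _)) uw) uv.
rewrite (finset.setUC [set v]%SET) (finset.setUC [set w]%SET [set u]%SET).
by case=> wvE []// uwE []// uvE; congruence.
Qed.

Hypothesis GN : forall u v w, exists x,
  [/\ e u x \in edges G, e v x \in edges G & e w x \in edges G].

(** A common neighbour [x] of [u], [v], [w] gives triangles [uvx] and [uwx], which share the side
    [ux]. *)
Lemma MD_adjacent_edges u v w :
  e u v \in edges G -> e u w \in edges G -> c (e u v) = c (e u w).
Proof.
move=> uv uw; have [x [ux vx wx]] := GN u v w.
rewrite (MD_triangle uv ux) 1?finset.setUC //; apply/esym.
by rewrite (MD_triangle uw ux) 1?finset.setUC.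
Qed.

(** For a common neighbour [y] of [u] and [w], consecutive edges of the walk [v u y w x] are
    adjacent. *)
Lemma MD_edges u v w x :
  e u v \in edges G -> e w x \in edges G -> c (e u v) = c (e w x).
Proof.
move=> uv wx; have [y [uy wy _]] := GN u w w.
have yu : e y u \in edges G by rewrite finset.setUC.
have yw : e y w \in edges G by rewrite finset.setUC.
rewrite (MD_adjacent_edges uv uy) -(MD_adjacent_edges wy wx).
by rewrite finset.setUC (MD_adjacent_edges yu yw) finset.setUC.
Qed.

End MD.

Lemma triples_common_neighbourP : 3 <= #|T| -> triples_common_neighbour G ->
  forall u v w, exists x, [/\ [set u; x]%SET \in edges G,
    [set v; x]%SET \in edges G & [set w; x]%SET \in edges G].
Proof.
move=> T3 /forallP GN u v w.
(* The vertices may coincide, so their set is first enlarged to exactly three elements. *)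
have [|S sS S3] := @superset_of_card T [set u; v; w]%SET 3.
  rewrite T3 andbT finset.setUC cardsU1 cards2.
  by case: (_ \notin _) (_ != _) => [] [].
have := GN S; rewrite S3 => /existsP[x /forall_inP xS]; exists x.
by split; apply: xS; apply: (fintype.subsetP sS); rewrite !inE eqxx ?orbT.
Qed.

Lemma triples_common_neighbour_md1 : 3 <= #|T| ->
  triples_common_neighbour G -> connected_graph G && (md G == 1).
Proof.
move=> T3 /(triples_common_neighbourP T3) GN.
have T0 : 0 < #|T| by apply: leq_trans T3.
apply/andP; split.
  rewrite /connected_graph T0; apply/forallP => u; apply/forallP => v.
  have [x [ux vx _]] := GN u v v.
  by apply: (@connect_trans _ _ x); apply: connect1; rewrite /adj // finset.setUC.
(* A coloring attaining [md G] has a singleton set of colors; it is nonempty because [ux] is an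
   edge. *)
have [C [c [cMD <-]]] := md_attained G.
have /card_gt0P[u _] := T0; have [x [ux _ _]] := GN u u u.
apply/cards1P; exists (c [set u; x]%SET); apply/finset.setP => k.
rewrite finset.in_set1; apply/imsetP/eqP => [[f fG ->]|->];
  last by exists [set u; x]%SET.
have := fintype.subsetP (edges_vpairs G) _ fG.
rewrite inE => /cards2P[a [b [_ ef]]]; rewrite ef in fG *.
exact: MD_edges.
Qed.

End Deterministic.

(** * Probability that some triple lacks a common neighbour *)

Section Probability.
Local Open Scope ring_scope.
Variables (R : realType) (p : R) (n : nat).

Lemma gnp_prE (A : pred (sgraph 'I_n)) :
  gnp_pr p A = \sum_G gnp_weight p G * (A G)%:R.
Proof.
rewrite /gnp_pr big_mkcond; apply: eq_bigr => G _.
by case: (A G); rewrite ?mulr1 ?mulr0.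
Qed.

Lemma gnp_prT : gnp_pr p (@predT (sgraph 'I_n)) = 1.
Proof.
have := @gnp_pr_indep R p n finset.set0 finset.set0
  (finset.sub0set _) (finset.sub0set _).
rewrite !cards0 !expr0 mulr1 => <-.
  apply: eq_bigl => G /=; rewrite finset.sub0set.
  by apply/esym/pred0P => e /=; rewrite finset.in_set0.
by apply/pred0P => e /=; rewrite finset.in_set0.
Qed.

Lemma gnp_prC (A : pred (sgraph 'I_n)) : gnp_pr p A = 1 - gnp_pr p (predC A).
Proof.
by apply/eqP; rewrite eq_sym subr_eq -gnp_prT /gnp_pr (bigID A).
Qed.

Lemma prod_natr_forall (T : finType) (Q P : pred T) :
  \prod_(x | Q x) (P x)%:R = [forall (x | Q x), P x]%:R :> R.
Proof.
have [/forall_inP PQ|] := boolP [forall (x | Q x), P x].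
  by rewrite big1 // => x /PQ ->.
rewrite negb_forall_in => /exists_inP[x Qx /negbTE Px].
by rewrite (bigD1 x) //= Px mul0r.
Qed.

(** Disjointness makes [s] and [x] recoverable from the unordered pair, as its members in [S] and in
    [J]. *)
Lemma card_star (T : finType) (S J : {set T}) : [disjoint S & J] ->
  #|[set [set s; x] | s in S, x in J]%SET| = (#|S| * #|J|)%N.
Proof.
move=> dSJ; rewrite curry_imset2X card_in_imset ?cardsX // => -[s x] [t y] /=.
rewrite !finset.in_setX /= => /andP[sS xJ] /andP[tS yJ] eE.
have : s \in [set t; y]%SET by rewrite -eE !inE eqxx.
have : x \in [set t; y]%SET by rewrite -eE !inE eqxx orbT.
rewrite !inE => /orP[/eqP xt|/eqP ->].
  by move: (disjointFr dSJ tS); rewrite -xt xJ.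
by case/orP => /eqP se; rewrite se // in sS *; rewrite (disjointFr dSJ sS) in yJ.
Qed.

Lemma gnp_pr_common_neighbours (S J : {set 'I_n}) :
  gnp_pr p [pred G | [forall x in J, common_neighbour (edges G) S x]] =
  \prod_(x in J) (if x \in S then 0 else p ^+ #|S|).
Proof.
have [dSJ|] := boolP [disjoint S & J]; last first.
  case/pred0Pn => x /= /andP[xS xJ].
  rewrite (bigD1 x) //= xS mul0r /gnp_pr big_pred0 // => G.
  apply/negP => /= /forall_inP /(_ x xJ) /forall_inP /(_ x xS).
  by move/edge_neq; rewrite eqxx.
pose A := [set [set s; x] | s in S, x in J]%SET.
transitivity (p ^+ #|A| * (1 - p) ^+ #|(finset.set0 : {set {set 'I_n}})|).
  rewrite -gnp_pr_indep ?finset.sub0set //.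
  - apply: eq_bigl => G /=; rewrite [X in _ && X](_ : _ = true) ?andbT; last first.
      by apply/pred0P => e /=; rewrite finset.in_set0.
    apply/forall_inP/fintype.subsetP => [AG e /imset2P[s x sS xJ ->]|AG x xJ].
      by have /forall_inP := AG x xJ; apply.
    by apply/forall_inP => s sS; apply: AG; apply: imset2_f.
  - apply/fintype.subsetP => e /imset2P[s x sS xJ ->].
    rewrite inE cards2; case: (eqVneq s x) => // sx.
    by rewrite sx (disjointFl dSJ xJ) in sS.
  - by apply/pred0P => e /=; rewrite finset.in_set0 andbF.
rewrite cards0 mulr1 card_star // exprM.
rewrite -prodr_const; apply: eq_bigr => x xJ.
by rewrite (disjointFl dSJ xJ).
Qed.

(* Inclusion-exclusion over the set [J] of vertices required to be common
   neighbours; the stars from [S] to the points of [J] are independent. *)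
Lemma gnp_pr_no_common_neighbour (S : {set 'I_n}) :
  gnp_pr p [pred G | ~~ [exists x, common_neighbour (edges G) S x]] =
  (1 - p ^+ #|S|) ^+ (n - #|S|).
Proof.
(* Used in both directions: to expand a product over indicators, then to refold the sum with
   probabilities in their place. *)
have expand (a : 'I_n -> R) :
    \prod_x (- a x + 1) = \sum_(J : {set 'I_n}) (-1) ^+ #|J| * \prod_(x in J) a x.
  rewrite bigA_distr; apply: eq_bigr => J _.
  rewrite -prodrN [RHS]big_mkcond; exact: eq_bigr.
transitivity (\sum_(J : {set 'I_n}) (-1) ^+ #|J| *
    gnp_pr p [pred G | [forall x in J, common_neighbour (edges G) S x]]).
  under eq_bigr do rewrite gnp_prE big_distrr /=.
  rewrite exchange_big gnp_prE; apply: eq_bigr => G _ /=.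
  rewrite negb_exists.
  transitivity (gnp_weight p G *
      \prod_x (- (common_neighbour (edges G) S x)%:R + 1)).
    congr (_ * _).
    rewrite -(prod_natr_forall predT (fun x => ~~ common_neighbour (edges G) S x)).
    by apply: eq_bigr => x _; case: common_neighbour; rewrite ?addNr ?oppr0 ?add0r.
  rewrite expand big_distrr; apply: eq_bigr => J _ /=.
  by rewrite prod_natr_forall mulrCA.
under eq_bigr do rewrite gnp_pr_common_neighbours.
(* Vertices of [S] contribute the factor 1, which leaves [n - #|S|] equal factors. *)
rewrite -expand (bigID (mem S)) /= big1 ?mul1r; last first.
  by move=> x ->; rewrite oppr0 add0r.
have -> : (n - #|S|)%N = #|(~: S)%SET|.
  by rewrite [RHS]cardsCs finset.setCK card_ord.
rewrite -prodr_const; apply: eq_big => [x|x /negbTE ->]; last by rewrite addrC.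
by rewrite finset.in_setC.
Qed.

Hypothesis p01 : 0 <= p <= 1.

Lemma gnp_weight_ge0 (G : sgraph 'I_n) : 0 <= gnp_weight p G.
Proof.
by case/andP: p01 => p0 p1; apply: prodr_ge0 => e _; case: ifP; rewrite ?subr_ge0.
Qed.

Lemma le_gnp_pr (A B : pred (sgraph 'I_n)) :
  (forall G, A G -> B G) -> gnp_pr p A <= gnp_pr p B.
Proof.
move=> AB; rewrite !gnp_prE; apply: ler_sum => G _.
apply: ler_wpM2l; first exact: gnp_weight_ge0.
by case: (A G) (AB G) => [-> //|_]; rewrite ler0n.
Qed.

Lemma gnp_pr_triples :
  gnp_pr p [pred G : sgraph 'I_n | ~~ triples_common_neighbour G] <=
  'C(n, 3)%:R * (1 - p ^+ 3) ^+ (n - 3).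
Proof.
apply: (@le_trans _ _ (\sum_(S : {set 'I_n} | #|S| == 3%N)
    gnp_pr p [pred G | ~~ [exists x, common_neighbour (edges G) S x]])).
  under [leRHS]eq_bigr do rewrite gnp_prE.
  (* The union bound, checked graph by graph: a failing graph has a bad triple, contributing 1 to
     the sum of indicators. *)
  rewrite exchange_big gnp_prE; apply: ler_sum => G _ /=.
  rewrite -big_distrr; apply: ler_wpM2l; first exact: gnp_weight_ge0.
  have [|] /= := boolP (triples_common_neighbour G).
    by move=> _; apply: sumr_ge0.
  rewrite negb_forall => /existsP[S]; rewrite negb_imply => /andP[S3 nS].
  by rewrite (bigD1 S) //= nS lerDl; apply: sumr_ge0.
rewrite (eq_bigr (fun=> (1 - p ^+ 3) ^+ (n - 3))); last first.
  by move=> S /eqP S3; rewrite gnp_pr_no_common_neighbour S3.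
by rewrite sumr_const mulr_natl -[in leRHS](card_ord n) -card_draws cardsE card_ord.
Qed.

End Probability.

(** * Decay of the union bound *)

Section Limit.
Local Open Scope ring_scope.
Local Open Scope classical_set_scope.

(* The term of degree [k+1] of [(1 + h)^n], with [1 + h = q^-1], beats
   ['C(n, k)] by a factor of order [n]. *)
Lemma cvg_bin_geometric (R : realType) (q : R) (k : nat) : 0 < q < 1 ->
  (fun n : nat => 'C(n, k)%:R * q ^+ (n - k)) @ \oo --> (0 : R).
Proof.
(* With [n = m + k.+1] the subtraction is not truncated, and degree [k.+1] occurs in the
   expansion. *)
case/andP=> q0 q1; rewrite -(cvg_shiftn k.+1).
pose h := q^-1 - 1.
have h0 : 0 < h by rewrite subr_gt0 invf_gt1.
(* Collects what remains besides [m.+1%:R^-1], since [q ^- N * q ^+ m.+1] equals [q ^- k]. *)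
pose K := k.+1%:R / h ^+ k.+1 / q ^+ k.
apply: (@squeeze_cvgr _ _ _ _ (fun=> 0) (fun m => K * harmonic m)).
- near=> m; rewrite /=; apply/andP; split.
    by rewrite mulr_ge0 ?ler0n ?exprn_ge0 ?ltW.
  have -> : (m + k.+1 - k = m.+1)%N by rewrite addnS -addSn addnK.
  set N := (m + k.+1)%N.
  have kN : (k.+1 < N.+1)%N by rewrite ltnS leq_addl.
  have binN : 'C(N, k)%:R = k.+1%:R * 'C(N, k.+1)%:R / m.+1%:R :> R.
    rewrite -natrM mul_bin_left natrM /N addnS -addSn addnK.
    by rewrite mulrAC mulfV ?mul1r // pnatr_eq0.
  have binh : 'C(N, k.+1)%:R * h ^+ k.+1 <= q ^- N.
    have -> : q ^- N = (h + 1) ^+ N by rewrite subrK exprVn.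
    rewrite exprD1n (bigD1 (Ordinal kN)) //= mulr_natl lerDl.
    by apply: sumr_ge0 => i _; rewrite mulrn_wge0 ?exprn_ge0 ?ltW.
  have hk : 0 < h ^+ k.+1 by rewrite exprn_gt0.
  have qk : 0 < q ^+ k by rewrite exprn_gt0.
  have qm : 0 < q ^+ m.+1 by rewrite exprn_gt0.
  rewrite -ler_pdivlMr // in binh.
  rewrite binN /K /harmonic /=.
  rewrite [leLHS](_ : _ =
    k.+1%:R * m.+1%:R^-1 * ('C(N, k.+1)%:R * q ^+ m.+1)); last first.
    by ring.
  rewrite [leRHS](_ : _ = k.+1%:R * m.+1%:R^-1 * (q ^- N / h ^+ k.+1 * q ^+ m.+1)).
    by rewrite ler_pM2l ?ler_pM2r // mulr_gt0 ?invr_gt0 ?ltr0n.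
  rewrite /N addnS -addSn exprD.
  by field; rewrite !gt_eqF ?ltr0n.
- exact: cvg_cst.
- by rewrite -[X in _ --> X](mulr0 K); apply: cvgMr; apply: cvg_harmonic.
Unshelve. all: by end_near.
Qed.

End Limit.

Local Open Scope classical_set_scope.
Local Open Scope ring_scope.

Theorem theorem3p3 (R : realType) :
  (fun n : nat =>
     gnp_pr (2^-1 : R)
       [pred G : sgraph 'I_n | connected_graph G && (md G == 1%N)])
    @ \oo --> (1 : R).
Proof.
have p01 : 0 <= (2^-1 : R) <= 1 by rewrite invr_ge0 ler0n invf_le1 ?ler1n.
have q01 : 0 < 1 - (2^-1 : R) ^+ 3 < 1.
  by rewrite subr_gt0 exprn_ilt1 ?invf_lt1 ?ltr1n ?invr_ge0 //=
    gtrBl exprn_gt0 ?invr_gt0.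
(* The lower bound is the complement of the union bound with ratio 7/8. *)
apply: (@squeeze_cvgr _ _ _ _
  (fun n => 1 - 'C(n, 3)%:R * (1 - 2^-1 ^+ 3) ^+ (n - 3)) (fun=> 1)); last 2 first.
- rewrite -[X in _ --> X](subr0 1).
  by apply: cvgB; [exact: cvg_cst | exact: cvg_bin_geometric].
- exact: cvg_cst.
near=> n; rewrite /=; apply/andP; split; last first.
  by rewrite -[leRHS](gnp_prT 2^-1 n); apply: le_gnp_pr.
apply: (@le_trans _ _ (gnp_pr 2^-1 (@triples_common_neighbour 'I_n))).
  by rewrite gnp_prC lerD2l lerN2; apply: gnp_pr_triples.
apply: le_gnp_pr => // G; apply: triples_common_neighbour_md1.
(* The deterministic criterion needs three vertices, hence only large [n]. *)
by rewrite card_ord; near: n; exact: nbhs_infty_ge.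
Unshelve. all: by end_near.
Qed.
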